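(* Consider a gamma model on $\mathcal{X}$ with inverse link. Let $g:\mathcal{X}\to\mathcal{Z}$ be one-to-one and onto and let $\mathbf{f}$ be linearly equivariant with respect to $g$ with nonsingular matrix $\mathbf{Q}_g$, i.e. $\mathbf{f}(g(\mathbf{x}))=\mathbf{Q}_g\mathbf{f}(\mathbf{x})$ for all $\mathbf{x}\in\mathcal{X}$. Let $\boldsymbol\beta\in\mathcal{B}$. Then for every $\tilde c>0$: (a) if $\xi^*$ is locally $D$-optimal on $\mathcal{X}$ at $\boldsymbol\beta$, then $(\xi^* )^g$ is locally $D$-optimal on $\mathcal{Z}$ at $\tilde{\boldsymbol\beta}=\tilde c\,\mathbf{Q}_g^{-\mathsf T}\boldsymbol\beta$; (b) if $\xi^*$ is locally $IMSE$-optimal on $\mathcal{X}$ at $\boldsymbol\beta$ with respect to a probability measure $\nu$ on $\mathcal{X}$, then $(\xi^* )^g$ is locally $IMSE$-optimal on $\mathcal{Z}$ at $\tilde{\boldsymbol\beta}=\tilde c\,\mathbf{Q}_g^{-\mathsf T}\boldsymbol\beta$ with respect to the image measure $\nu^g$.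
   Context: $\mathbf{f}$ is a vector of $p$ real regression functions defined on $\mathcal{X}$ and on $\mathcal{Z}$, linearly independent on $\mathcal{X}$; $\mathcal{B}\subseteq\mathbb{R}^p$ is the parameter region of all $\boldsymbol\beta$ with $\mathbf{f}(\mathbf{x})^{\mathsf T}\boldsymbol\beta>0$ for all $\mathbf{x}\in\mathcal{X}$. A design $\xi$ on a region is given by finitely many distinct support points $\mathbf{x}_i$ of the region and weights $w_i>0$, $\sum_iw_i=1$. The image $\xi^g$ is the design on $\mathcal{Z}$ with support points $g(\mathbf{x}_i)$ and weights $w_i$; $\nu^g$ is the pushforward of $\nu$ under $g$. In the gamma model with inverse link the intensity is $\lambda(z)=\kappa/z^2$ ($z>0$, $\kappa>0$ fixed; used on both $\mathcal{X}$ and $\mathcal{Z}$), the information matrix is $\mathbf{M}(\xi;\boldsymbol\beta)=\sum_iw_i\,\kappa(\mathbf{f}(\mathbf{x}_i)^{\mathsf T}\boldsymbol\beta)^{-2}\,\mathbf{f}(\mathbf{x}_i)\mathbf{f}(\mathbf{x}_i)^{\mathsf T}$, and $\mathbf{V}(\boldsymbol\beta;\nu)=\int\kappa^2(\mathbf{f}(\mathbf{x})^{\mathsf T}\boldsymbol\beta)^{-4}\,\mathbf{f}(\mathbf{x})\mathbf{f}(\mathbf{x})^{\mathsf T}\,\nu(\mathrm{d}\mathbf{x})$. A design is locally $D$-optimal at $\boldsymbol\beta$ on a region if it minimizes $\det(\mathbf{M}(\xi;\boldsymbol\beta)^{-1})$, and locally $IMSE$-optimal at $\boldsymbol\beta$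 with respect to $\nu$ if it minimizes $\mathrm{trace}(\mathbf{V}(\boldsymbol\beta;\nu)\mathbf{M}(\xi;\boldsymbol\beta)^{-1})$, over all designs on that region; both criteria are $\infty$ for singular $\mathbf{M}(\xi;\boldsymbol\beta)$. $\mathbf{f}$, $g$, $g^{-1}$ are measurable and the integrals $\mathbf{V}$ are finite. $\mathbf{Q}^{-\mathsf T}$ denotes the inverse of the transpose of $\mathbf{Q}$. *)

(* Defs.v *)
From HB Require Import structures.
From mathcomp Require Import all_boot all_order all_algebra.
From mathcomp Require Import all_classical all_reals all_analysis.

Set Implicit Arguments.
Unset Strict Implicit.
Unset Printing Implicit Defensive.

Import Order.TTheory GRing.Theory Num.Theory.

Local Open Scope classical_set_scope.
Local Open Scope ring_scope.

Section Regression.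
Context {R : realType} {T : Type} {p : nat}.
Implicit Types (f : T -> 'cV[R]_p) (beta : 'cV[R]_p).

Definition linear_predictor f beta (x : T) : R := ((f x)^T *m beta) 0 0.

Definition linearly_independent f : Prop :=
  forall c : 'cV[R]_p, (forall x, linear_predictor f c x = 0) -> c = 0.

Definition parameter_region f : set 'cV[R]_p :=
  [set beta | forall x, 0 < linear_predictor f beta x].

End Regression.

(* The order in which the support points are listed is irrelevant to all the
   notions below.  The weights summing to 1 forces at least one point. *)
Record design (R : realType) (T : Type) := Design {
  design_size : nat;
  design_point : 'I_design_size -> T;
  design_weight : 'I_design_size -> R;
  design_point_inj : injective design_point;
  design_weight_gt0 : forall i, 0 < design_weight i;
  design_weight_sum1 : \sum_i design_weight i = 1
}.

(* Injectivity of g keeps the image points distinct, so that no weights need to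
   be merged. *)
Definition design_image (R : realType) (T U : Type) (g : T -> U)
    (g_inj : injective g) (xi : design R T) : design R U :=
  @Design R U (design_size xi) (g \o @design_point R T xi)
    (@design_weight R T xi)
    (inj_comp g_inj (@design_point_inj R T xi))
    (@design_weight_gt0 R T xi) (@design_weight_sum1 R T xi).

Section Criteria.
Context {R : realType}.

(* Only meaningful for z > 0. *)
Definition intensity (kappa z : R) : R := kappa / z ^+ 2.

Definition information_matrix (kappa : R) {T : Type} {p : nat}
    (f : T -> 'cV[R]_p) (beta : 'cV[R]_p) (xi : design R T) : 'M[R]_p :=
  \sum_(i < design_size xi)
    (design_weight i * intensity kappa (linear_predictor f beta (design_point i)))
      *: (f (design_point i) *m (f (design_point i))^T).

Definition D_criterion (kappa : R) {T : Type} {p : nat}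
    (f : T -> 'cV[R]_p) (beta : 'cV[R]_p) (xi : design R T) : \bar R :=
  let M := information_matrix kappa f beta xi in
  if M \in unitmx then (\det (invmx M))%:E else +oo%E.

Definition locally_D_optimal (kappa : R) {T : Type} {p : nat}
    (f : T -> 'cV[R]_p) (beta : 'cV[R]_p) (xi : design R T) : Prop :=
  forall xi' : design R T,
    (D_criterion kappa f beta xi <= D_criterion kappa f beta xi')%E.

Definition imse_integrand (kappa : R) {T : Type} {p : nat}
    (f : T -> 'cV[R]_p) (beta : 'cV[R]_p) (x : T) : 'M[R]_p :=
  (kappa ^+ 2 / linear_predictor f beta x ^+ 4) *: (f x *m (f x)^T).

Definition imse_integrable (kappa : R) {d : measure_display}
    {T : measurableType d} {p : nat} (f : T -> 'cV[R]_p) (beta : 'cV[R]_p)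
    (nu : probability T R) : Prop :=
  forall i j : 'I_p,
    nu.-integrable [set: T] (fun x => (imse_integrand kappa f beta x i j)%:E).

Definition imse_matrix (kappa : R) {d : measure_display}
    {T : measurableType d} {p : nat} (f : T -> 'cV[R]_p) (beta : 'cV[R]_p)
    (nu : probability T R) : 'M[R]_p :=
  \matrix_(i, j) Rintegral nu [set: T] (fun x => imse_integrand kappa f beta x i j).

Definition IMSE_criterion (kappa : R) {d : measure_display}
    {T : measurableType d} {p : nat} (f : T -> 'cV[R]_p) (beta : 'cV[R]_p)
    (nu : probability T R) (xi : design R T) : \bar R :=
  let M := information_matrix kappa f beta xi in
  if M \in unitmx
  then (\tr (imse_matrix kappa f beta nu *m invmx M))%:E else +oo%E.

Definition locally_IMSE_optimal (kappa : R) {d : measure_display}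
    {T : measurableType d} {p : nat} (f : T -> 'cV[R]_p) (beta : 'cV[R]_p)
    (nu : probability T R) (xi : design R T) : Prop :=
  forall xi' : design R T,
    (IMSE_criterion kappa f beta nu xi <= IMSE_criterion kappa f beta nu xi')%E.

End Criteria.

(* Main.v *)
(** The predictor at [g x] for the transformed parameter [c Q^-T beta] is [c]
    times the predictor at [x] for [beta].  Hence the information matrix of the
    image design is [c^-2 Q M Q^T] and the IMSE weighting matrix of the image
    measure is [c^-4 Q V Q^T], so each criterion is multiplied by a positive
    constant independent of the design.  As every design on [Z] is the image of
    a design on [X], minimizers are mapped to minimizers. *)

Require Import Defs.
From HB Require Import structures.
From mathcomp Require Import all_boot all_order all_algebra.
From mathcomp Require Import all_classical all_reals all_analysis.
From mathcomp Require Import ring.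

Import Order.TTheory GRing.Theory Num.Theory.
Local Open Scope classical_set_scope.
Local Open Scope ring_scope.

Set Implicit Arguments.
Unset Strict Implicit.

(** Transposing [Q *m fX x] puts [Q^T] directly before [invmx Q^T], and the two cancel. *)
Lemma linear_predictor_equivariant (R : realType) (X Z : Type) (p : nat)
    (fX : X -> 'cV[R]_p) (fZ : Z -> 'cV[R]_p) (g : X -> Z) (Q : 'M[R]_p)
    (beta : 'cV[R]_p) (c : R) :
  Q \in unitmx -> (forall x, fZ (g x) = Q *m fX x) ->
  forall x, linear_predictor fZ (c *: (invmx Q^T *m beta)) (g x)
            = c * linear_predictor fX beta x.
Proof.
move=> Qu fE x; rewrite /linear_predictor fE trmx_mul -scalemxAr mxE.
by rewrite -mulmxA mulKVmx ?unitmx_tr.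
Qed.

Lemma outer_mulmx (R : realType) (p : nat) (Q : 'M[R]_p) (u : 'cV[R]_p) :
  (Q *m u) *m (Q *m u)^T = Q *m (u *m u^T) *m Q^T.
Proof. by rewrite trmx_mul !mulmxA. Qed.

Lemma information_matrix_image (R : realType) (X Z : Type) (p : nat)
    (fX : X -> 'cV[R]_p) (fZ : Z -> 'cV[R]_p) (g : X -> Z)
    (g_inj : injective g) (Q : 'M[R]_p) (kappa : R) (beta : 'cV[R]_p) (c : R)
    (xi : design R X) :
  Q \in unitmx -> (forall x, fZ (g x) = Q *m fX x) ->
  information_matrix kappa fZ (c *: (invmx Q^T *m beta))
    (design_image g_inj xi)
  = c ^- 2 *: (Q *m information_matrix kappa fX beta xi *m Q^T).
Proof.
move=> Qu fE; rewrite /information_matrix /=.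
rewrite mulmx_sumr mulmx_suml scaler_sumr; apply: eq_bigr => i _.
rewrite (linear_predictor_equivariant _ _ Qu fE) fE.
rewrite outer_mulmx -scalemxAr -scalemxAl scalerA; congr (_ *: _).
(* Inversion is total with [0^-1 = 0], so [invfM] splits the inverse of the product even at a
   vanishing predictor. *)
by rewrite /intensity exprMn invfM; ring.
Qed.

(** Both criteria see a design only through its information matrix. Stating the round trip at this
    level avoids comparing [design] records and their proof fields. *)
Lemma information_matrix_imageK (R : realType) (X Z : Type) (p : nat)
    (fZ : Z -> 'cV[R]_p) (g : X -> Z) (h : Z -> X) (g_inj : injective g)
    (h_inj : injective h) (kappa : R) (beta : 'cV[R]_p) (xi : design R Z) :
  cancel h g ->
  information_matrix kappa fZ beta (design_image g_inj (design_image h_inj xi))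
  = information_matrix kappa fZ beta xi.
Proof. by move=> hK; apply: eq_bigr => i _ /=; rewrite hK. Qed.

(** Ensures that a design and its image fall into the same branch of each criterion, finite or
    [+oo]. *)
Lemma unitmx_congruence (R : realType) (p : nat) (Q M : 'M[R]_p) (a : R) :
  a != 0 -> Q \in unitmx ->
  (a *: (Q *m M *m Q^T) \in unitmx) = (M \in unitmx).
Proof.
by move=> a0 Qu; rewrite unitmxZ ?unitfE // !unitmx_mul unitmx_tr Qu andbT.
Qed.

Lemma invmx_congruence (R : realType) (p : nat) (Q M : 'M[R]_p) (a : R) :
  a != 0 -> Q \in unitmx -> M \in unitmx ->
  invmx (a *: (Q *m M *m Q^T))
  = a^-1 *: ((invmx Q)^T *m invmx M *m invmx Q).
Proof.
move=> a0 Qu Mu.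
have Nu : a *: (Q *m M *m Q^T) \in unitmx by rewrite unitmx_congruence.
(* Left multiplication by an invertible matrix is injective, so it suffices that the candidate is a
   right inverse. *)
apply: (can_inj (mulKmx Nu)); rewrite mulmxV // -scalemxAl -scalemxAr scalerA.
rewrite divff // scale1r trmx_inv !mulmxA mulmxK ?unitmx_tr //.
by rewrite mulmxK // mulmxV.
Qed.

Lemma D_criterion_image (R : realType) (X Z : Type) (p : nat)
    (fX : X -> 'cV[R]_p) (fZ : Z -> 'cV[R]_p) (g : X -> Z)
    (g_inj : injective g) (Q : 'M[R]_p) (kappa : R) (beta : 'cV[R]_p) (c : R)
    (xi : design R X) :
  0 < c -> Q \in unitmx -> (forall x, fZ (g x) = Q *m fX x) ->
  D_criterion kappa fZ (c *: (invmx Q^T *m beta)) (design_image g_inj xi)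
  = (((c ^+ 2) ^+ p / \det Q ^+ 2)%:E * D_criterion kappa fX beta xi)%E.
Proof.
move=> c0 Qu fE; have c2 : c ^- 2 != 0 by rewrite invr_neq0 // expf_neq0 ?gt_eqF.
have dQ : \det Q != 0 by rewrite -unitfE -unitmxE.
rewrite /D_criterion (information_matrix_image _ _ _ _ _ Qu fE) //.
rewrite unitmx_congruence //; case: ifPn => Mu; last first.
  (* Singular case: [+oo] absorbs the factor because the factor is strictly positive. *)
  rewrite gt0_muley // lte_fin; apply: divr_gt0; first by rewrite !exprn_gt0.
  by rewrite exprn_even_gt0.
rewrite invmx_congruence // detZ !det_mulmx det_tr det_inv invrK -EFinM.
by congr (_%:E); rewrite !det_inv -exprVn; ring.
Qed.

(** The scalar is [c ^- 4] from the weighting matrix times [c ^+ 2] from the inverse information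
    matrix. [Q^T] meets its inverse inside the product, and cyclicity of the trace brings [invmx Q]
    in front of [Q]. The relation between the weighting matrices is assumed here, which keeps the
    argument purely algebraic. *)
Lemma IMSE_criterion_image (R : realType) (dX dZ : measure_display)
    (X : measurableType dX) (Z : measurableType dZ) (p : nat)
    (fX : X -> 'cV[R]_p) (fZ : Z -> 'cV[R]_p) (g : X -> Z)
    (g_inj : injective g) (Q : 'M[R]_p) (kappa : R) (beta : 'cV[R]_p) (c : R)
    (nu : probability X R) (mu : probability Z R) (xi : design R X) :
  0 < c -> Q \in unitmx -> (forall x, fZ (g x) = Q *m fX x) ->
  imse_matrix kappa fZ (c *: (invmx Q^T *m beta)) mu
  = c ^- 4 *: (Q *m imse_matrix kappa fX beta nu *m Q^T) ->
  IMSE_criterion kappa fZ (c *: (invmx Q^T *m beta)) mu (design_image g_inj xi)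
  = ((c ^- 2)%:E * IMSE_criterion kappa fX beta nu xi)%E.
Proof.
move=> c0 Qu fE VE.
have c2 : c ^- 2 != 0 by rewrite invr_neq0 // expf_neq0 ?gt_eqF.
rewrite /IMSE_criterion VE (information_matrix_image _ _ _ _ _ Qu fE) //.
rewrite unitmx_congruence //; case: ifPn => Mu; last first.
  by rewrite gt0_muley // lte_fin invr_gt0 exprn_gt0.
rewrite invmx_congruence // -EFinM; congr (_%:E).
rewrite invrK -scalemxAl -scalemxAr scalerA mxtraceZ trmx_inv !mulmxA.
rewrite mulmxK ?unitmx_tr // mxtrace_mulC !mulmxA mulVmx // mul1mx.
by congr (_ * _); field; rewrite gt_eqF.
Qed.

Lemma Rintegral_lincomb (R : realType) (d : measure_display)
    (T : measurableType d) (mu : {measure set T -> \bar R}) (I : finType)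
    (a : I -> R) (F : I -> T -> R) :
  (forall k, mu.-integrable [set: T] (fun x => (F k x)%:E)) ->
  mu.-integrable [set: T] (fun x => (\sum_k a k * F k x)%:E) /\
  Rintegral mu [set: T] (fun x => \sum_k a k * F k x)
  = \sum_k a k * Rintegral mu [set: T] (F k).
Proof.
move=> Fi.
have aFi k : mu.-integrable [set: T] (fun x => (a k * F k x)%:E).
  by under eq_fun do rewrite EFinM; exact: integrableZl.
have sumE : (fun x => (\sum_k a k * F k x)%:E)
            = (fun x => \sum_k (a k * F k x)%:E)%E.
  by apply/funext => x; rewrite sumEFin.
split; first by rewrite sumE; exact: integrable_sum.
(* [fine] commutes with the sum only because every summand has a finite integral. *)
rewrite /Rintegral sumE integral_sum // -sum_fine; last first.
  by move=> k _; exact: integrable_fin_num.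
by apply: eq_bigr => k _; apply: RintegralZl => //; exact: Fi.
Qed.

(** Each entry of [A *m F x *m B] is a linear combination of the entries of [F x], indexed by pairs,
    with coefficients independent of [x]. The integrability conclusion serves the change of
    variables below. *)
Lemma Rintegral_mulmx (R : realType) (d : measure_display)
    (T : measurableType d) (mu : {measure set T -> \bar R}) (m n p q : nat)
    (A : 'M[R]_(m, n)) (B : 'M[R]_(p, q)) (F : T -> 'M[R]_(n, p))
    (H : T -> 'M[R]_(m, q)) i j :
  (forall x, H x = A *m F x *m B) ->
  (forall k l, mu.-integrable [set: T] (fun x => (F x k l)%:E)) ->
  mu.-integrable [set: T] (fun x => (H x i j)%:E) /\
  Rintegral mu [set: T] (fun x => H x i j)
  = (A *m (\matrix_(k, l) Rintegral mu [set: T] (fun x => F x k l)) *m B) i j.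
Proof.
move=> HE Fi.
have mulE (M : 'M[R]_(n, p)) :
    (A *m M *m B) i j
    = \sum_(kl : 'I_p * 'I_n) A i kl.2 * B kl.1 j * M kl.2 kl.1.
  rewrite mxE -(pair_bigA _ (fun k l => A i l * B k j * M l k)) /=.
  apply: eq_bigr => k _; rewrite mxE mulr_suml.
  by apply: eq_bigr => l _; rewrite mulrAC.
have [Ii IE] := @Rintegral_lincomb R d T mu _ (fun kl => A i kl.2 * B kl.1 j)
  (fun kl x => F x kl.2 kl.1) (fun kl => Fi kl.2 kl.1).
under eq_fun do rewrite HE mulE; split => //.
under [in LHS]eq_fun do rewrite HE mulE.
by rewrite IE mulE; apply: eq_bigr => kl _; rewrite mxE.
Qed.

Lemma imse_matrix_distribution (R : realType) (dX dZ : measure_display)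
    (X : measurableType dX) (Z : measurableType dZ) (p : nat)
    (fX : X -> 'cV[R]_p) (fZ : Z -> 'cV[R]_p)
    (g : {mfun X >-> Z}) (h : {mfun Z >-> X}) (Q : 'M[R]_p) (kappa : R)
    (beta : 'cV[R]_p) (c : R) (nu : probability X R) :
  cancel h g -> Q \in unitmx -> (forall x, fZ (g x) = Q *m fX x) ->
  imse_integrable kappa fX beta nu ->
  imse_matrix kappa fZ (c *: (invmx Q^T *m beta)) (distribution nu g)
  = c ^- 4 *: (Q *m imse_matrix kappa fX beta nu *m Q^T).
Proof.
move=> hK Qu fE Fi.
(* The scalar is absorbed into the left factor, so that the integrand has the form constant matrix,
   integrand on [X], constant matrix. *)
have gE x : imse_integrand kappa fZ (c *: (invmx Q^T *m beta)) (g x)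
            = (c ^- 4 *: Q) *m imse_integrand kappa fX beta x *m Q^T.
  rewrite /imse_integrand (linear_predictor_equivariant _ _ Qu fE) //.
  rewrite fE outer_mulmx -!scalemxAl -scalemxAr -scalemxAl scalerA.
  by congr (_ *: _); rewrite exprMn invfM; ring.
apply/matrixP => i j; rewrite [LHS]mxE 2![in RHS]scalemxAl.
have [gi gI] := Rintegral_mulmx i j gE Fi.
rewrite -gI /Rintegral; congr fine.
rewrite (integral_distribution _ gi) //.
(* The integrand on [Z] is its composite with [g], measurable on [X], composed
   with the measurable inverse of [g]. *)
rewrite (_ : (fun z => _) = (fun x => (imse_integrand kappa fZ
    (c *: (invmx Q^T *m beta)) (g x) i j)%:E) \o h); last first.
  by apply/funext => z /=; rewrite hK.
apply: (measurable_comp measurableT) => //; exact: measurable_int gi.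
Qed.

Unset Implicit Arguments.
Set Strict Implicit.

Theorem corollary6 (R : realType) (dX dZ : measure_display)
  (X : measurableType dX) (Z : measurableType dZ) (p : nat)
  (fX : X -> 'cV[R]_p) (fZ : Z -> 'cV[R]_p)
  (fX_meas : forall i, measurable_fun [set: X] (fun x => fX x i 0))
  (fZ_meas : forall i, measurable_fun [set: Z] (fun z => fZ z i 0))
  (fX_indep : linearly_independent fX)
  (g : {mfun X >-> Z}) (ginv : {mfun Z >-> X})
  (gK : cancel g ginv) (ginvK : cancel ginv g)
  (Q : 'M[R]_p) (Q_unit : Q \in unitmx)
  (f_equiv : forall x : X, fZ (g x) = Q *m fX x)
  (kappa : R) (kappa_gt0 : 0 < kappa)
  (beta : 'cV[R]_p) (beta_region : parameter_region fX beta)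
  (c : R) (c_gt0 : 0 < c) :
  (forall xi : design R X,
     locally_D_optimal kappa fX beta xi ->
     locally_D_optimal kappa fZ (c *: (invmx Q^T *m beta))
       (design_image (can_inj gK) xi))
  /\
  (forall nu : probability X R,
     imse_integrable kappa fX beta nu ->
     forall xi : design R X,
     locally_IMSE_optimal kappa fX beta nu xi ->
     locally_IMSE_optimal kappa fZ (c *: (invmx Q^T *m beta))
       (distribution nu g) (design_image (can_inj gK) xi)).
Proof.
have hI := can_inj ginvK; split=> [xi xi_opt|nu nu_int xi xi_opt] xi'.
- have -> : D_criterion kappa fZ (c *: (invmx Q^T *m beta)) xi'
    = D_criterion kappa fZ (c *: (invmx Q^T *m beta))
        (design_image (can_inj gK) (design_image hI xi')).
    by rewrite /D_criterion information_matrix_imageK.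
  (* Both sides now carry the same nonnegative factor; what remains is optimality of [xi] against
     the pulled-back competitor [design_image hI xi']. *)
  rewrite !(D_criterion_image _ _ _ _ c_gt0 Q_unit f_equiv) // lee_wpmul2l //.
  by rewrite lee_fin divr_ge0 ?sqr_ge0 // !exprn_ge0 // ltW.
- have -> : IMSE_criterion kappa fZ (c *: (invmx Q^T *m beta))
      (distribution nu g) xi'
    = IMSE_criterion kappa fZ (c *: (invmx Q^T *m beta)) (distribution nu g)
        (design_image (can_inj gK) (design_image hI xi')).
    by rewrite /IMSE_criterion information_matrix_imageK.
  (* This relation does not involve the design, so it rescales the criterion of [xi] and of its
     competitor alike. *)
  have VE := imse_matrix_distribution c ginvK Q_unit f_equiv nu_int.
  rewrite !(IMSE_criterion_image _ _ c_gt0 Q_unit f_equiv VE) //.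
  by rewrite lee_wpmul2l // lee_fin invr_ge0 exprn_ge0 // ltW.
Qed.
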